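(* Let $S = \langle n_1, n_2 \rangle$ be a numerical semigroup with two generators $n_1 < n_2$. Then $$\sum_{n \in S} \widehat\chi_{\mathsf{M}_S}(\Delta_n)\, t^n = -n_1 t^{n_1n_2} \qquad \text{and} \qquad \sum_{n \in S} \widehat\chi_{\mathsf{m}_S}(\Delta_n)\, t^n = -n_2 t^{n_1n_2}.$$
   Context: A numerical semigroup is a subset $S \subseteq \mathbb{Z}_{\ge 0}$ containing $0$, closed under addition, with finite complement; $S = \langle n_1, n_2\rangle$ means $S$ is generated by the positive integers $n_1 < n_2$ (so $\gcd(n_1,n_2)=1$). A factorization of $n \in S$ is $(a_1,a_2) \in \mathbb{Z}_{\ge 0}^2$ with $n = a_1n_1 + a_2n_2$; its length is $a_1 + a_2$. $\mathsf{M}_S(n)$ and $\mathsf{m}_S(n)$ are the maximum and minimum factorization lengths of $n \in S$. For $F \subseteq \{1,2\}$ put $n_F = \sum_{i \in F} n_i$. For $n \in S$, the squarefree divisor complex $\Delta_n$ has as faces the $F \subseteq \{1,2\}$ (including $F=\emptyset$) with $n - n_F \in S$. For $f = \mathsf{M}_S$ or $\mathsf{m}_S$, the augmented Euler characteristic is $$\widehat\chi_f(\Delta_n) = \sum_{F \in \Delta_n} (-1)^{|F|} \big(f(n - n_F) + |F|\big).$$ *)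

(* Defs.v *)
From mathcomp Require Import all_boot all_order all_algebra.
Set Implicit Arguments. Unset Strict Implicit. Unset Printing Implicit Defensive.
Import GRing.Theory.

Definition numerical_semigroup (S : {pred nat}) : Prop :=
  [/\ 0 \in S,
      forall x y, x \in S -> y \in S -> x + y \in S
    & exists s : seq nat, forall n, n \notin S -> n \in s].

Section Factorizations.
Variables (k : nat) (g : k.-tuple nat).

(* Coordinates are bounded by n only to make the set finite: when all the
   generators are positive nothing is lost, see [factorizationsP]. *)
Definition factorizations (n : nat) : {set {ffun 'I_k -> 'I_n.+1}} :=
  [set a : {ffun 'I_k -> 'I_n.+1} | n == \sum_(i < k) a i * tnth g i].

Definition generated : {pred nat} := [pred n | factorizations n != set0].

Definition fact_length n (a : {ffun 'I_k -> 'I_n.+1}) : nat := \sum_(i < k) a i.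

Definition max_length (n : nat) : nat :=
  \max_(a in factorizations n) fact_length a.

(* The default value n is an upper bound on the factorization lengths of n
   (positive generators), so it is harmless for n in the semigroup, see
   [min_lengthP]. *)
Definition min_length (n : nat) : nat :=
  \big[minn/n]_(a in factorizations n) fact_length a.

Definition gen_sum (F : {set 'I_k}) : nat := \sum_(i in F) tnth g i.

(* As subtraction on nat is truncated, the first conjunct expresses that the
   integer n - gen_sum F is nonnegative. *)
Definition squarefree_divisor_complex (n : nat) : {set {set 'I_k}} :=
  [set F : {set 'I_k} | (gen_sum F <= n) && (n - gen_sum F \in generated)].

Definition augmented_euler_char (f : nat -> nat) (n : nat) : int :=
  (\sum_(F in squarefree_divisor_complex n)
     (-1) ^+ #|F| * ((f (n - gen_sum F)%N)%:Z + #|F|%:Z))%R.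

Lemma coord_le (g_gt0 : forall i, 0 < tnth g i) n (b : 'I_k -> nat) i :
  n = \sum_(i < k) b i * tnth g i -> b i <= n.
Proof.
move=> ->; rewrite (bigD1 i) //=.
by apply: leq_trans (leq_addr _ _); rewrite leq_pmulr.
Qed.

Lemma factorizationsP (g_gt0 : forall i, 0 < tnth g i) n (b : 'I_k -> nat) :
  n = \sum_(i < k) b i * tnth g i <->
  exists2 a, a \in factorizations n & forall i, a i = b i :> nat.
Proof.
split=> [nE | [a]]; last first.
  by rewrite inE => /eqP nE ab; rewrite [LHS]nE; apply: eq_bigr => i _; rewrite ab.
have bn i : b i < n.+1 by rewrite ltnS; apply: (coord_le g_gt0) nE.
exists [ffun i => Ordinal (bn i)] => [|i]; last by rewrite ffunE.
by rewrite inE {1}nE; apply/eqP/eq_bigr => i _; rewrite ffunE.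
Qed.

Lemma generatedP (g_gt0 : forall i, 0 < tnth g i) n :
  n \in generated <-> exists b : 'I_k -> nat, n = \sum_(i < k) b i * tnth g i.
Proof.
split=> [/set0Pn[a] | [b /(factorizationsP g_gt0)[a an _]]]; last by apply/set0Pn; exists a.
by rewrite inE => /eqP nE; exists (fun i => nat_of_ord (a i)).
Qed.

Lemma max_lengthP n : n \in generated ->
  (exists2 a, a \in factorizations n & fact_length a = max_length n) /\
  (forall a, a \in factorizations n -> fact_length a <= max_length n).
Proof.
rewrite inE -card_gt0 => n_gen; split=> [|a an]; last exact: leq_bigmax_cond.
by have [a an aE] := eq_bigmax_cond (@fact_length n) n_gen; exists a.
Qed.

Lemma min_lengthP (g_gt0 : forall i, 0 < tnth g i) n : n \in generated ->
  (exists2 a, a \in factorizations n & fact_length a = min_length n) /\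
  (forall a, a \in factorizations n -> min_length n <= fact_length a).
Proof.
have len_le (a : {ffun 'I_k -> 'I_n.+1}) : a \in factorizations n -> fact_length a <= n.
  by rewrite inE => /eqP nE; rewrite [leqRHS]nE; apply: leq_sum => i _; rewrite leq_pmulr.
move=> /set0Pn[a0 a0n].
case: (arg_minnP (@fact_length n) a0n) => a an amin.
suff <- : fact_length a = min_length n by split=> //; exists a.
apply/eqP; rewrite eqn_leq; apply/andP; split.
  apply: (big_ind (fun x => fact_length a <= x)) => [|x y ax ay|]; first exact: len_le.
    by rewrite leq_min ax.
  exact: amin.
rewrite /min_length; elim: (index_enum _) (mem_index_enum a) => [//|b s IHs].
rewrite in_cons big_cons => /predU1P[<-|/IHs le_s]; first by rewrite ifT ?geq_minl.
by case: ifP => // _; apply: leq_trans (geq_minr _ _) le_s.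
Qed.

End Factorizations.

(* A formal power series over int is given by its sequence of coefficients,
   n |-> [t^n]. *)
Definition power_series := nat -> int.

Definition series_over (S : {pred nat}) (c : nat -> int) : power_series :=
  fun n => if n \in S then c n else 0%R.

Definition monomial (c : int) (d : nat) : power_series :=
  fun n => if n == d then c else 0%R.

(* Main.v *)
(** Over coprime generators [p] and [q], every element of the semigroup is
    [x * p + y * q] for a unique pair with [y < p], all its other factorizations
    being [(x - k * q, y + k * p)] with [k > 0].  This normal form has maximal
    length when [p <= q] and minimal length when [q <= p], so that both series
    are instances of one computation, with [(p, q) = (n1, n2)] for the maximum
    and [(n2, n1)] for the minimum.  Removing [p] lowers [x]; removing [q] lowers
    [y], or, when [y = 0], replaces [(x, 0)] by [(x - q, p - 1)].  The lengths
    cancel in the Euler characteristic unless [(x, y) = (q, 0)], where the face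
    for [q] is present but the one for [p] and [q] together is not. *)

Require Import Defs.
From mathcomp Require Import all_boot all_order all_algebra.
From mathcomp Require Import zify.

(** [p] divides the difference of [y] and [v] times [q], hence the difference itself by
    coprimality. *)
Lemma pair_rep_shift (p q x y u v : nat) :
  coprime p q -> 0 < q -> y < p -> x * p + y * q = u * p + v * q ->
  exists k, v = y + k * p /\ x = u + k * q.
Proof.
move=> cpq q_gt0 ltyp eq_rep.
(* If [v < y], then [y - v] would be a multiple of [p] strictly between 0 and [p]. *)
have le_yv : y <= v.
  rewrite leqNgt; apply/negP => lt_vy.
  have : p %| (y - v) * q.
    have -> : (y - v) * q = (u - x) * p by nia.
    exact: dvdn_mull.
  by rewrite Gauss_dvdl // => /dvdn_leq; lia.
have : p %| (v - y) * q.
  have -> : (v - y) * q = (x - u) * p by nia.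
  exact: dvdn_mull.
rewrite Gauss_dvdl // => /dvdnP[k kE]; exists k; split; first lia.
have vE : v = y + k * p by lia.
by apply/eqP; rewrite -(eqn_pmul2r (leq_ltn_trans (leq0n y) ltyp)); nia.
Qed.

Lemma pair_normal_form (p q u v : nat) : 0 < p ->
  exists x y, y < p /\ u * p + v * q = x * p + y * q.
Proof.
(* Each block of [p] copies of [q] is traded for [q] copies of [p]. *)
move=> p_gt0; exists (u + (v %/ p) * q), (v %% p).
split; first by rewrite ltn_mod.
by rewrite {1}(divn_eq v p); lia.
Qed.

Lemma big_set_ord2 (G : {set 'I_2} -> int) :
  (\sum_(F : {set 'I_2}) G F =
   G set0 + G [set ord0] + G [set ord_max] + G setT)%R.
Proof.
have set_eq (A B : {set 'I_2}) :
    (A == B) = ((ord0 \in A) == (ord0 \in B)) && ((ord_max \in A) == (ord_max \in B)).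
  apply/eqP/andP => [-> // | [/eqP e0 /eqP e1]]; apply/setP => i.
  by case: (unliftP ord0 i) => [j|] -> //; rewrite (ord1 j) (_ : lift _ _ = ord_max) //; apply: val_inj.
rewrite (bigD1 set0) //= (bigD1 [set ord0]) /=; last by rewrite set_eq !inE.
rewrite (bigD1 [set ord_max]) /=; last by rewrite !set_eq !inE.
rewrite (bigD1 setT) /=; last by rewrite !set_eq !inE.
rewrite big1 ?GRing.addr0 ?GRing.addrA // => F.
by rewrite !set_eq !inE; do 2!case: (_ \in F).
Qed.

Lemma augmented_euler_char_pair (p q : nat) (f : nat -> nat) (n : nat) :
  let S := generated [tuple p; q] in
  augmented_euler_char [tuple p; q] f n =
  ((if n \in S then (f n)%:Z else 0)
   - (if (p <= n)%N && ((n - p)%N \in S) then (f (n - p)%N)%:Z + 1 else 0)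
   - (if (q <= n)%N && ((n - q)%N \in S) then (f (n - q)%N)%:Z + 1 else 0)
   + (if (p + q <= n)%N && ((n - (p + q))%N \in S)
      then (f (n - (p + q))%N)%:Z + 2 else 0))%R.
Proof.
move=> S; rewrite /augmented_euler_char big_mkcond big_set_ord2 !inE.
have s0 : gen_sum [tuple p; q] set0 = 0 by rewrite /gen_sum big_set0.
have s1 : gen_sum [tuple p; q] [set ord0] = p by rewrite /gen_sum big_set1.
have s2 : gen_sum [tuple p; q] [set ord_max] = q by rewrite /gen_sum big_set1.
have s3 : gen_sum [tuple p; q] setT = p + q.
  rewrite /gen_sum (eq_bigl xpredT) => [|i]; last by rewrite inE.
  by rewrite big_ord_recl big_ord1.
rewrite s0 s1 s2 s3 cards0 !cards1 cardsT card_ord !subn0 /= -/S.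
by do 4!case: ifP => _; lia.
Qed.

Section PairLengths.
Variables (p q : nat).
Hypotheses (p_gt0 : 0 < p) (q_gt0 : 0 < q).

Let gens_gt0 i : 0 < tnth [tuple p; q] i.
Proof. by case: (unliftP ord0 i) => [j|] -> //; rewrite (ord1 j). Qed.

Lemma fact_length_pairP n l :
  (exists2 a, a \in factorizations [tuple p; q] n & fact_length a = l) <->
  exists x y, n = x * p + y * q /\ l = x + y.
Proof.
split=> [[a an <-] | [x [y [nE ->]]]].
  move: an; rewrite inE => /eqP nE.
  exists (a ord0), (a ord_max).
  by rewrite [LHS]nE /fact_length !big_ord_recr !big_ord0 /= !add0n;
     split; congr (_ + _); (congr (_ * _) || idtac); congr (nat_of_ord (a _)); apply: val_inj.
have [/(_ _)[]] := factorizationsP gens_gt0 n (fun i => if i == ord0 then x else y).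
  by rewrite big_ord_recr big_ord1.
move=> a an aE _; exists a => //.
by rewrite /fact_length big_ord_recr big_ord1 !aE.
Qed.

Lemma generated_pairP n :
  n \in generated [tuple p; q] <-> exists x y, n = x * p + y * q.
Proof.
split=> [/set0Pn[a an] | [x [y nE]]].
  have [/(_ _)[]] := fact_length_pairP n (fact_length a); first by exists a.
  by move=> x [y [nE _]] _; exists x, y.
have [_ [|a an _]] := fact_length_pairP n (x + y); first by exists x, y.
by apply/set0Pn; exists a.
Qed.

(** A factorization [(x - k * q, y + k * p)] has length [x + y - k * (q - p)]. *)
Lemma max_length_pair x y : coprime p q -> p <= q -> y < p ->
  max_length [tuple p; q] (x * p + y * q) = x + y.
Proof.
move=> cpq le_pq ltyp; set n := x * p + y * q.
have nS : n \in generated [tuple p; q] by apply/generated_pairP; exists x, y.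
have [max_ex max_ge] := max_lengthP nS.
have /fact_length_pairP[u [v [eq_n maxE]]] := max_ex; rewrite maxE.
have [a an al] : exists2 a, a \in factorizations [tuple p; q] n & fact_length a = x + y.
  by apply/fact_length_pairP; exists x, y.
have := max_ge _ an; rewrite al maxE.
by have [k [-> ->]] := pair_rep_shift _ _ _ _ _ _ cpq q_gt0 ltyp eq_n; nia.
Qed.

Lemma min_length_pair x y : coprime p q -> p <= q -> x < q ->
  min_length [tuple p; q] (x * p + y * q) = x + y.
Proof.
move=> cpq le_pq ltxq; set n := x * p + y * q.
have nS : n \in generated [tuple p; q] by apply/generated_pairP; exists x, y.
have [min_ex min_le] := min_lengthP gens_gt0 nS.
have /fact_length_pairP[u [v [eq_n minE]]] := min_ex; rewrite minE.
have [a an al] : exists2 a, a \in factorizations [tuple p; q] n & fact_length a = x + y.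
  by apply/fact_length_pairP; exists x, y.
have := min_le _ an; rewrite al minE.
(* Here the first coordinate is the reduced one, so the shift is applied to the pair [(q, p)]. *)
rewrite /n addnC [RHS]addnC in eq_n; rewrite coprime_sym in cpq.
by have [k [-> ->]] := pair_rep_shift _ _ _ _ _ _ cpq p_gt0 ltxq eq_n; nia.
Qed.

Lemma numerical_semigroup_coprime :
  numerical_semigroup (generated [tuple p; q]) -> coprime p q.
Proof.
move=> [_ _ [s sP]]; set d := gcdn p q.
have d_gt0 : 0 < d by rewrite gcdn_gt0 p_gt0.
(* [m] exceeds every gap, so it lies in the semigroup, yet it is 1 modulo [d]; hence [d] divides
   1. *)
pose m := (\max_(i <- s) i).+1 * d + 1.
have /generated_pairP[x [y mE]] : m \in generated [tuple p; q].
  apply: contraT => /sP ms.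
  have : m <= \max_(i <- s) i by exact: leq_bigmax_seq.
  by rewrite /m; nia.
have : d %| m by rewrite mE dvdn_add // dvdn_mull // (dvdn_gcdl, dvdn_gcdr).
by rewrite /m dvdn_addr ?dvdn_mull // dvdn1.
Qed.

End PairLengths.

(** [S] and [f] are abstract so that [p] and [q] can be exchanged while both still refer to
    [[tuple n1; n2]]. *)
Lemma normal_form_euler_char (p q : nat) (S : {pred nat}) (f : nat -> nat) (n : nat) :
  0 < p -> 0 < q -> coprime p q ->
  (forall m, m \in S <-> exists x y, m = x * p + y * q) ->
  (forall x y, y < p -> f (x * p + y * q) = x + y) ->
  n \in S ->
  ((f n)%:Z
   - (if (p <= n)%N && ((n - p)%N \in S) then (f (n - p)%N)%:Z + 1 else 0)
   - (if (q <= n)%N && ((n - q)%N \in S) then (f (n - q)%N)%:Z + 1 else 0)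
   + (if (p + q <= n)%N && ((n - (p + q))%N \in S)
      then (f (n - (p + q))%N)%:Z + 2 else 0))%R
  = monomial (- p%:Z)%R (p * q) n.
Proof.
move=> p_gt0 q_gt0 cpq SP fE /SP[u0 [v0 nE]].
have [x [y [ltyp]]] := pair_normal_form p q u0 v0 p_gt0.
rewrite -nE => {u0 v0} {}nE.
have face_in i j x' y' : y' < p -> n = x' * p + y' * q + (i * p + j * q) ->
    (i * p + j * q <= n) && (n - (i * p + j * q) \in S) = true /\
    f (n - (i * p + j * q)) = x' + y'.
  move=> lty' ->; rewrite leq_addl addnK fE //; split=> //.
  by apply/SP; exists x', y'.
(* A face is absent when no shift of [(x, y)] has coordinates at least [i] and [j]. *)
have face_out i j : (forall u v k, v + j = y + k * p -> x = u + i + k * q -> False) ->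
    (i * p + j * q <= n) && (n - (i * p + j * q) \in S) = false.
  move=> out; apply/negP => /andP[le_n /SP[u [v uvE]]].
  have eq_n : x * p + y * q = (u + i) * p + (v + j) * q by lia.
  by have [k [vk xk]] := pair_rep_shift _ _ _ _ _ _ cpq q_gt0 ltyp eq_n; apply: (out u v k).
have fn : f n = x + y by rewrite nE fE.
have monE : monomial (- p%:Z)%R (p * q) n =
    (if (x == q) && (y == 0) then - p%:Z else 0)%R.
  rewrite /monomial; congr (if _ then _ else _); apply/eqP/andP; last first.
    by case=> /eqP xq /eqP y0; rewrite nE xq y0; lia.
  move=> npq; have eq_n : x * p + y * q = q * p + 0 * q by lia.
  have [k [k0 xk]] := pair_rep_shift _ _ _ _ _ _ cpq q_gt0 ltyp eq_n; split; apply/eqP; last by nia.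
  have /eqP : k * p = 0 by lia.
  by rewrite muln_eq0 => /orP[/eqP k_0|]; lia.
rewrite monE fn.
have := face_in 1 0; have := face_out 1 0; rewrite mul1n mul0n addn0 => out10 in10.
have := face_in 0 1; have := face_out 0 1; rewrite mul1n mul0n add0n => out01 in01.
have := face_in 1 1; have := face_out 1 1; rewrite !mul1n => out11 in11.
case: (posnP y) => [y0 | y_gt0]; last first.
  have [-> ->] : _ /\ _ := in01 x y.-1 ltac:(lia) ltac:(nia).
  case: (posnP x) => [x0 | x_gt0].
    rewrite out10; last by move=> *; lia.
    rewrite out11; last by move=> *; lia.
    by case: ifP; lia.
  have [-> ->] : _ /\ _ := in10 x.-1 y ltyp ltac:(nia).
  have [-> ->] : _ /\ _ := in11 x.-1 y.-1 ltac:(lia) ltac:(nia).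
  by case: ifP; lia.
(* As [y = 0], using a copy of [q] forces a shift with [k > 0], which costs at least [q] copies of
   [p]. *)
have no_wrap v k : v + 1 = y + k * p -> q <= k * q by case: k; nia.
case: (ltngtP x q) => [lt_xq | lt_qx | xq].
- rewrite out01; last by move=> u v k /no_wrap; lia.
  rewrite out11; last by move=> u v k /no_wrap; lia.
  case: (posnP x) => [x0 | x_gt0].
    by rewrite out10; [rewrite /=; lia | move=> *; lia].
  by have [-> ->] : _ /\ _ := in10 x.-1 y ltyp ltac:(nia); rewrite /=; lia.
- have [-> ->] : _ /\ _ := in10 x.-1 y ltyp ltac:(nia).
  have [-> ->] : _ /\ _ := in01 (x - q) p.-1 ltac:(lia) ltac:(nia).
  have [-> ->] : _ /\ _ := in11 (x - q).-1 p.-1 ltac:(lia) ltac:(nia).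
  by rewrite /=; lia.
(* The surviving coefficient: the empty face gives [q], the face of [p] gives [- q], and the face of
   [q], with remainder [(0, p - 1)], gives [- p]. *)
- have [-> ->] : _ /\ _ := in10 x.-1 y ltyp ltac:(nia).
  have [-> ->] : _ /\ _ := in01 (x - q) p.-1 ltac:(lia) ltac:(nia).
  rewrite out11; last by move=> u v k /no_wrap; lia.
  by rewrite y0 /=; lia.
Qed.

Theorem theorem6p1 (n1 n2 : nat) (n1_gt0 : 0 < n1) (lt_n1_n2 : n1 < n2)
    (S_numerical : numerical_semigroup (generated [tuple n1; n2])) :
  series_over (generated [tuple n1; n2])
    (augmented_euler_char [tuple n1; n2] (max_length [tuple n1; n2]))
    =1 monomial (- n1%:Z)%R (n1 * n2)
  /\
  series_over (generated [tuple n1; n2])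
    (augmented_euler_char [tuple n1; n2] (min_length [tuple n1; n2]))
    =1 monomial (- n2%:Z)%R (n1 * n2).
Proof.
have n2_gt0 : 0 < n2 by apply: leq_ltn_trans lt_n1_n2.
have c12 := numerical_semigroup_coprime _ _ n1_gt0 n2_gt0 S_numerical.
have genP := generated_pairP _ _ n1_gt0 n2_gt0.
(* The exponent [n1 * n2] itself lies in the semigroup, so the monomial vanishes outside it. *)
have off_S c n : n \notin generated [tuple n1; n2] -> 0%R = monomial c (n1 * n2) n.
  move=> nS; rewrite /monomial; case: eqP => // nE; case/negP: nS.
  by apply/genP; exists 0, n1.
split=> n; rewrite /series_over; case: ifPn => [nS | /off_S //];
  rewrite augmented_euler_char_pair nS.
  apply: normal_form_euler_char => // x y.
  by apply: max_length_pair => //; apply: ltnW.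
(* The generators exchange roles for the minimum: the two vertex terms are swapped to match. *)
rewrite (mulnC n1 n2) (addnC n1 n2) (GRing.addrAC _ (- _)%R (- _)%R).
apply: normal_form_euler_char => // [|m|x y lt_y]; first by rewrite coprime_sym.
  by split=> [/genP|] [x [y ->]]; [|apply/genP]; exists y, x; rewrite addnC.
by rewrite addnC min_length_pair ?(ltnW lt_n1_n2) // addnC.
Qed.
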